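(* For any partition $\lambda$, $$\tilde H_\lambda(x;q,t)=\sum_{C\in \mathcal C(\cdot,\lambda)} q^{\mathrm{betrayal}(C)}\, t^{\mathrm{cocharge}(C)}\, x^{\mathrm{shape}(C)},$$ where $\mathcal C(\cdot,\lambda)$ is the set of all circloids of weight $\lambda$ (of arbitrary shape) and $\tilde H_\lambda(x;q,t)$ is the modified Macdonald polynomial.
   Context: Compositions are finite sequences $\gamma=(\gamma_1,\gamma_2,\dots)$ of non-negative integers, identified when they differ only by trailing zeros; $|\gamma|=\sum_i\gamma_i$ and $x^\gamma=\prod_i x_i^{\gamma_i}$. For a partition $\lambda$, $\lambda'_c=\#\{r:\lambda_r\ge c\}$. Its shape is the set of cells $(r,c)$, $1\le c\le\lambda_r$, with row $r$ counted upward from the bottom and column $c$ from left to right. Modified Macdonald polynomial. A filling $F$ of shape $\lambda$ is an assignment of a positive integer $F_{(r,c)}$ to each cell of $\lambda$; its weight is the composition whose $i$-th entry is the number of $i$'s in $F$. Put $\mathrm{maj}(F)=\sum (\lambda'_c-r+1)$ over cells $(r,c)$, $r\ge2$, with $F_{(r,c)}>F_{(r-1,c)}$. An inversion triple of $F$ consists of two cells $(i,c),(i,c')$ with $c<c'$ of the same row, with entries $u=F_{(i,c)}$, $w=F_{(i,c')}$, and $v=F_{(i-1,c)}$ ($v=0$ if $i=1$), such that $u=v\neq w$, or $u>w>v$, or $w>v>u$, or $v>u>w$. $\mathrm{inv}(F)$ is the number of inversion triples. Then $$\tilde H_\lambda(x;q,t)=\sum_{F} q^{\mathrm{inv}(F)}t^{\mathrm{maj}(F)}x^{\mathrm{weight}(F)}$$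 over all fillings $F$ of shape $\lambda$. Circloids. A colored letter $x_y$ is a positive integer $x$ (the letter) with a positive integer subscript $y$ (the color). Prismatic order: $u_v>r_c$ iff $r<u$, or $r=u$ and $c>v$. A circloid $C$ of weight $\lambda$ and shape $\gamma$ (with $|\gamma|=|\lambda|$) is a placement of the colored letters $x_y$, $1\le y\le\lambda_x$, each used exactly once, on the perimeter of a circle subdivided into sectors $1,2,\dots$ read clockwise from a marked point $\star$, so that sector $s$ contains $\gamma_s$ colored letters and, read clockwise, the letters in each sector are in decreasing prismatic order. Cocharge. Let $w=w_1\cdots w_m$ be a permutation of $1,\dots,m$ written counter-clockwise on a circle with $\star$ between $w_1$ and $w_m$, so that clockwise from $\star$ one reads $w_m,\dots,w_1$. Label the letter $1$ with $0$; label $i$ with the label of $i-1$ if $\star$ is passed when reading clockwise from $i-1$ to $i$, and otherwise with the label of $i-1$ plus $1$. The cocharge is the sum of the labels. For a circloid $C$ of partition weight $\lambda$, let $C_i$ be the sub-configuration of colored letters with color $i$; its letters are $1,\dots,\lambda'_i$, each once. Then $\mathrm{cocharge}(C)=\sum_{i=1}^{\lambda_1}\mathrm{cocharge}(C_i)$. Betrayal. $\mathrm{betrayal}(C)=\sum_{i\ge1}\sum_j s_{i,j}$, where $j$ runs over the colors for which $i_j$ occurs in $C$ and $s_{i,j}$ is the number of colored letters $i_{k}$ with $k>j$ which are passed when reading clockwise from $(i-1)_j$ to $i_j$ in $C$, with the convention $0_j=\star$. *)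

(* Defs.v *)
From HB Require Import structures.
From mathcomp Require Import all_boot all_order all_algebra.
From mathcomp Require Import finmap.
From mathcomp Require Import boolp classical_sets functions cardinality fsbigop.

Set Implicit Arguments.
Unset Strict Implicit.
Unset Printing Implicit Defensive.

Import GRing.Theory.
Local Open Scope ring_scope.
Local Open Scope classical_set_scope.

(* Compositions are finite sequences of naturals; two of them denote the same
   composition when they agree up to trailing zeros. *)
Definition comp_eq (ga de : seq nat) : Prop := forall i, nth 0%N ga i = nth 0%N de i.

(* A formal power series in x_1, x_2, ... over Z[q, t], given by its
   coefficients: S ga is the coefficient of x^ga. *)
Definition Zqt : Type := {poly {poly int}}.
Definition qvar : Zqt := 'X.
Definition tvar : Zqt := 'X%:P.
Definition xseries : Type := seq nat -> Zqt.

(* The series \sum_(i in A) c i * x^(m i).  The coefficient sum is a genuine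
   one when only finitely many i in A have m i equal to a given composition;
   see finite_filling_fibre and finite_circloid_fibre below. *)
Definition formal_sum (I : choiceType) (A : set I) (c : I -> Zqt)
    (m : I -> seq nat) : xseries :=
  fun ga => \sum_(i \in [set i | A i /\ comp_eq (m i) ga]) c i.

Local Open Scope nat_scope.

(* Weakly decreasing; trailing zeros are allowed and immaterial. *)
Definition is_partition (la : seq nat) : bool := sorted geq la.

(* 1-based: part la r is the r-th part; part la 0 = 0. *)
Definition part (la : seq nat) (r : nat) : nat := nth 0 (0 :: la) r.

(* The conjugate part la'_c, for c >= 1. *)
Definition conj_part (la : seq nat) (c : nat) : nat := count (leq c) la.

(* The pairs (r, c) with 1 <= r and 1 <= c <= la_r, without repetition: both
   the cells (r, c) of the shape la and the colored letters r_c with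
   1 <= c <= la_r. *)
Definition cells (la : seq nat) : seq (nat * nat) :=
  [seq (r, c) | r <- iota 1 (size la), c <- iota 1 (part la r)].

(* Entries are positive on the shape, and 0 is the value off the shape. *)
Definition filling_of (la : seq nat) (F : {fsfun nat * nat -> nat with 0}) :
  Prop := forall x, (0 < F x) = (x \in cells la).

Definition filling_weight (la : seq nat) (F : nat * nat -> nat) : seq nat :=
  [seq count (fun x => F x == i) (cells la)
     | i <- iota 1 (\max_(x <- cells la) F x)].

(* The subtraction is exact: r <= la'_c for every cell (r, c) of a partition. *)
Definition filling_maj (la : seq nat) (F : nat * nat -> nat) : nat :=
  \sum_(x <- cells la | (2 <= x.1) && (F (x.1.-1, x.2) < F x))
     (conj_part la x.2 - x.1 + 1).

Definition inversion_triple (F : nat * nat -> nat) (x y : nat * nat) : bool :=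
  let u := F x in
  let w := F y in
  let v := if x.1 == 1 then 0 else F (x.1.-1, x.2) in
  [&& x.1 == y.1, x.2 < y.2 &
    [|| (u == v) && (v != w), (u > w) && (w > v), (w > v) && (v > u) |
        (v > u) && (u > w)]].

Definition filling_inv (la : seq nat) (F : nat * nat -> nat) : nat :=
  \sum_(x <- cells la) count (inversion_triple F x) (cells la).

Definition modified_macdonald (la : seq nat) : xseries :=
  formal_sum [set F | filling_of la F]
    (fun F => qvar ^+ filling_inv la F * tvar ^+ filling_maj la F)%R
    (filling_weight la).

(* The colored letter x_y is the pair (x, y). *)
Definition prism_gt (a b : nat * nat) : bool :=
  (b.1 < a.1) || ((b.1 == a.1) && (b.2 > a.2)).

(* A circloid is the sequence of its sectors 1, 2, ..., each sector being the
   word of colored letters read clockwise in it.  Empty sectors after the last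
   nonempty one are dropped, so that each circloid has one representation. *)
Definition circloid_shape (C : seq (seq (nat * nat))) : seq nat := map size C.

Definition is_circloid (la : seq nat) (C : seq (seq (nat * nat))) : bool :=
  [&& last 1 (circloid_shape C) != 0, all (sorted prism_gt) C &
      perm_eq (flatten C) (cells la)].

(* The circle on which w is read clockwise from the marked point, which is
   represented by None.  For distinct a and b on it, path.arc (circle w) a b
   runs clockwise from a included to b excluded. *)
Definition circle (T : Type) (w : seq T) : seq (option T) := None :: map Some w.

(* Here w = w_1 ... w_m is written counter-clockwise, as is customary for
   cocharge, so that the clockwise reading is rev w. *)
Fixpoint cocharge_label (w : seq nat) (i : nat) : nat :=
  match i with
  | 0 | 1 => 0
  | (j.+1) as i' =>
      if None \in arc (circle (rev w)) (Some j) (Some i') then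
        cocharge_label w j
      else (cocharge_label w j).+1
  end.

Definition cocharge_perm (w : seq nat) : nat :=
  \sum_(1 <= i < (size w).+1) cocharge_label w i.

(* The letters of color j, read counter-clockwise. *)
Definition color_word (C : seq (seq (nat * nat))) (j : nat) : seq nat :=
  rev [seq x.1 | x <- flatten C & x.2 == j].

Definition cocharge (la : seq nat) (C : seq (seq (nat * nat))) : nat :=
  \sum_(1 <= j < (part la 1).+1) cocharge_perm (color_word C j).

(* The point of the circle holding (i-1)_j, with 0_j the marked point. *)
Definition letter_below (x : nat * nat) : option (nat * nat) :=
  if x.1 == 1 then None else Some (x.1.-1, x.2).

Definition betrayal (C : seq (seq (nat * nat))) : nat :=
  \sum_(x <- flatten C)
    count (fun p => if p is Some y then (y.1 == x.1) && (x.2 < y.2) else false)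
          (arc (circle (flatten C)) (letter_below x) (Some x)).

Lemma comp_eq_shape_take (s ga : seq nat) :
  last 1 s != 0 -> comp_eq s ga -> size s <= size ga /\ s = take (size s) ga.
Proof.
move=> hs E.
have le: size s <= size ga.
  case: s hs E => [//|a s] hs E.
  rewrite leqNgt; apply/negP => lt.
  have := E (size s); rewrite [RHS]nth_default; last by rewrite -ltnS.
  by move=> E0; move: hs; rewrite (last_nth 0) /= E0.
split=> //; apply: (@eq_from_nth _ 0) => [|i hi]; first by rewrite size_takel.
by rewrite nth_take //; apply: E.
Qed.

Lemma finite_circloid_fibre (la ga : seq nat) :
  finite_set [set C | is_circloid la C /\ comp_eq (circloid_shape C) ga].
Proof.
apply: (sub_finite_set _ (finite_seq
  [seq reshape (take m ga) w | m <- iota 0 (size ga).+1,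
                               w <- permutations (cells la)])).
move=> C [/and3P[hl _ hp] /(comp_eq_shape_take hl)[hs E]].
apply/allpairsPdep; exists (size (circloid_shape C)), (flatten C); split.
- by rewrite mem_iota add0n ltnS.
- by rewrite mem_permutations.
- by rewrite -E flattenK.
Qed.

Lemma finite_filling_fibre (la ga : seq nat) :
  finite_set [set F | filling_of la F /\ comp_eq (filling_weight la F) ga].
Proof.
pose N := size ga; pose K := [fset x in cells la]%fset.
pose mk (g : {ffun K -> 'I_N.+1}) : {fsfun nat * nat -> nat with 0} :=
  [fsfun x : K => (g x : nat) | 0]%fset.
apply: (sub_finite_set _ (finite_seq
  [seq mk g | g : {ffun K -> 'I_N.+1}])) => F /= [hF hw].
have bound x : x \in cells la -> F x <= N.
  move=> hx; have Fx0 : 0 < F x by rewrite hF.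
  rewrite leqNgt; apply/negP => lt.
  have /eqP := hw (F x).-1; rewrite [X in _ == X]nth_default; last first.
    by rewrite -ltnS prednK.
  have hm : F x <= \max_(y <- cells la) F y.
    exact: leq_bigmax_seq.
  rewrite /filling_weight (nth_map 0) ?size_iota ?prednK //.
  rewrite nth_iota ?prednK // add1n prednK // -leqn0 leqNgt -has_count.
  by move/negP; apply; apply/hasP; exists x => /=.
apply/mapP; exists [ffun x : K => inord (F (val x))]; first by rewrite mem_enum.
apply/fsfunP => x; rewrite /mk fsfun_ffun.
case: insubP => [[y hy] _ /= <- |] /=.
  rewrite ffunE inordK //= ltnS; apply: bound.
  by move: hy; rewrite inE.
by rewrite inE -hF lt0n negbK => /eqP.
Qed.

(* Main.v *)
(** Placing the letter r_c in sector F(r, c) turns a filling F into a circloid,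
and this bijection carries weight to shape and respects both statistics term by
term.  The marked point is passed between (r-1)_c and r_c exactly when (r, c) is
not a descent, and a descent in row r raises the labels of the letters
r, ..., la'_c of color c by one each, which is its contribution to maj.  Since
ties in a sector are broken by the prismatic order, r_k (with k > c) is passed
between (r-1)_c and r_c exactly when the cells (r, c), (r, k) form an inversion
triple. *)

Require Import Defs.
From mathcomp Require Import all_boot all_order all_algebra.
From mathcomp Require Import finmap.
From mathcomp Require Import boolp classical_sets functions cardinality fsbigop.
From mathcomp Require Import zify.

Set Implicit Arguments.
Unset Strict Implicit.
Unset Printing Implicit Defensive.

(** * Cyclic arcs in sorted words *)

Lemma index_rot (T : eqType) (n : nat) (s : seq T) (x : T) :
  uniq s -> x \in s -> n <= size s ->
  index x (rot n s) =
    if n <= index x s then index x s - n else index x s + (size s - n).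
Proof.
move=> us xs le_ns; have := us; rewrite -{1}(cat_take_drop n s) cat_uniq.
case/and3P=> _ /hasPn disj _.
have := index_cat x (take n s) (drop n s).
have := xs; rewrite -{1}(cat_take_drop n s) mem_cat cat_take_drop => + ->.
rewrite /rot index_cat size_takel //.
case x_drop: (x \in drop n s).
  by rewrite (negPf (disj _ x_drop)) leq_addr addKn.
rewrite orbF => x_take; rewrite x_take size_drop.
by move: (x_take); rewrite -index_mem size_takel // ltnNge => /negPf ->; rewrite addnC.
Qed.

(** The second disjunct is the arc that runs off the end of [s] and resumes at its start. *)
Lemma mem_arc_index (T : eqType) (s : seq T) (a b y : T) :
  uniq s -> a \in s -> b \in s -> y \in s ->
  (y \in arc s a b) =
    (index a s <= index y s < index b s) ||
    (index b s < index a s) && ((index a s <= index y s) || (index y s < index b s)).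
Proof.
move=> us ha hb hy; rewrite /arc in_take ?mem_rot //.
have le : index a s <= size s by rewrite index_size.
rewrite !index_rot //.
move: ha hb hy; rewrite -!index_mem; do 2![case: ifP]; lia.
Qed.

Lemma index_sorted (T : eqType) (r : rel T) (s : seq T) (x y : T) :
  transitive r -> irreflexive r -> sorted r s -> x \in s -> y \in s ->
  (index x s < index y s) = r x y.
Proof.
move=> rt ri rs xs ys; apply/idP/idP => [|rxy].
  exact: (sorted_ltn_index rt rs).
rewrite ltnNge leq_eqVlt; apply/negP => /orP[/eqP /index_inj E|].
  by rewrite E // ri in rxy.
by move/(sorted_ltn_index rt rs y x ys xs)/(rt _ _ _ rxy); rewrite ri.
Qed.

(** The three cases are the linear forms of the cyclic order [a], [y], [b], according to where the
    circle is cut; [y != a] makes the comparison with [a] strict. *)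
Lemma mem_arc_sorted (T : eqType) (r : rel T) (s : seq T) (a b y : T) :
  transitive r -> irreflexive r -> sorted r s ->
  a \in s -> b \in s -> y \in s -> y != a ->
  (y \in arc s a b) = [|| r a y && r y b, r y b && r b a | r b a && r a y].
Proof.
move=> rt ri rs ha hb hy ya.
have neq : index y s != index a s.
  by apply: contra ya => /eqP /index_inj ->.
rewrite mem_arc_index ?(sorted_uniq rt ri) // -!(index_sorted rt ri rs) //.
lia.
Qed.

(** Serves to turn a count along an arc into a count over the whole circle, with membership in the
    arc as a test. *)
Lemma count_sub_uniq (T : eqType) (P : pred T) (s t : seq T) :
  uniq s -> uniq t -> {subset s <= t} ->
  count P s = count (fun x => P x && (x \in s)) t.
Proof.
move=> us ut st; rewrite -(count_filter P (mem s)).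
apply/permP/uniq_perm; rewrite ?filter_uniq // => x.
by rewrite mem_filter /=; case xs: (x \in s); rewrite ?(st x xs).
Qed.

(** The marked point [None] starts the clockwise reading, so it is put below every letter. *)
Definition circle_rel {T : Type} (r : rel T) : rel (option T) :=
  fun p q => match p, q with
             | None, Some _ => true
             | Some x, Some y => r x y
             | _, None => false
             end.

Lemma circle_rel_trans (T : Type) (r : rel T) :
  transitive r -> transitive (circle_rel r).
Proof. by move=> rt [y|] [x|] [z|] //=; apply: rt. Qed.

Lemma circle_rel_irr (T : Type) (r : rel T) :
  irreflexive r -> irreflexive (circle_rel r).
Proof. by move=> ri [x|] //=. Qed.

Lemma circle_sorted (T : Type) (r : rel T) (s : seq T) :
  transitive r -> sorted r s -> sorted (circle_rel r) (circle s).
Proof.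
move=> rt; rewrite (sorted_pairwise rt) (sorted_pairwise (circle_rel_trans rt)) /=.
by rewrite pairwise_map all_map => ->; rewrite andbT all_predT.
Qed.

Lemma mem_circle (T : eqType) (s : seq T) (x : T) :
  (Some x \in circle s) = (x \in s).
Proof. by rewrite in_cons /= mem_map // => ? ? []. Qed.

(** * Cells by rows and by columns *)

Lemma mem_cells (la : seq nat) (x : nat * nat) :
  (x \in cells la) = [&& 0 < x.1, 0 < x.2 & x.2 <= part la x.1].
Proof.
case: x => r c; apply/allpairsPdep/idP => /=.
  by move=> [r' [c' [+ + [-> ->]]]]; rewrite !mem_iota; lia.
move=> /and3P[r0 c0 cr]; exists r, c; rewrite !mem_iota; split=> //; last lia.
case: r r0 cr => // r _; rewrite /part /=.
by have [le|] := leqP (size la) r; [rewrite nth_default //; lia|lia].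
Qed.

Lemma cells_uniq (la : seq nat) : uniq (cells la).
Proof.
apply: allpairs_uniq_dep => [|r _|]; rewrite ?iota_uniq //.
by move=> [r c] [r' c'] _ _ /= [-> ->].
Qed.

(** The parts that are at least [c] form an initial segment of [la]; [0 < c] keeps the default value
    0 past the end out of it. *)
Lemma leq_nth_conj_part (la : seq nat) (i c : nat) :
  is_partition la -> 0 < c -> (c <= nth 0 la i) = (i < conj_part la c).
Proof.
move=> + c0; elim: la i => [|a la IH] i /= hp; first by rewrite nth_nil; lia.
have hla : is_partition la by case: la hp {IH} => //= b la /andP[].
rewrite /conj_part /= -/(conj_part la c).
have ge_trans : transitive geq by move=> ? ? ? /=; lia.
have [ca|ac] := leqP c a; first by case: i => [|i] /=; [lia|rewrite IH].
have le_a : all (geq a) la by apply: order_path_min hp.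
have -> : conj_part la c = 0.
  apply/eqP; rewrite -leqn0 leqNgt -has_count; apply/negP => /hasP[b + cb].
  by move/(allP le_a) => /=; lia.
case: i => [|i] /=; first lia.
have [ge|lt] := leqP (size la) i; first by rewrite nth_default //; lia.
by have := allP le_a _ (mem_nth 0 lt) => /=; lia.
Qed.

Lemma mem_cells_conj (la : seq nat) (x : nat * nat) : is_partition la ->
  (x \in cells la) = [&& 0 < x.2, 0 < x.1 & x.1 <= conj_part la x.2].
Proof.
move=> hla; rewrite mem_cells; case: x => [[|r] c] /=; first by rewrite andbF.
by case: c => [|c] //=; rewrite /part /= leq_nth_conj_part.
Qed.

(** Cocharge groups the letters by color, so maj has to be summed column by column for the
    comparison. *)
Lemma cells_perm_columns (la : seq nat) : is_partition la ->
  perm_eq (cells la)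
    [seq (r, c) | c <- iota 1 (part la 1), r <- iota 1 (conj_part la c)].
Proof.
move=> hla; apply: uniq_perm; rewrite ?cells_uniq //.
  apply: allpairs_uniq_dep => [|c _|]; rewrite ?iota_uniq //.
  by move=> [c r] [c' r'] _ _ /= [-> ->].
move=> [r c]; rewrite mem_cells_conj //=; apply/idP/allpairsPdep.
  move=> /and3P[c0 r0 rc]; exists c, r; rewrite !mem_iota; split=> //; last lia.
  have : 0 < conj_part la c by lia.
  by rewrite -leq_nth_conj_part // /part /=; lia.
by move=> [c' [r' [+ + [-> ->]]]]; rewrite !mem_iota; lia.
Qed.

(** * The bijection from fillings to circloids *)

(* For the circle on which each letter x lies in sector F x; sectors are read in
   decreasing prismatic order, so within a sector the larger letter comes first. *)
Definition clockwise (F : nat * nat -> nat) : rel (nat * nat) :=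
  fun x y => (F x < F y) || (F x == F y) && prism_gt x y.

Lemma prism_gt_trans : transitive prism_gt.
Proof. by move=> [? ?] [? ?] [? ?]; rewrite /prism_gt /=; lia. Qed.

Lemma clockwise_trans F : transitive (clockwise F).
Proof. by move=> [? ?] [? ?] [? ?]; rewrite /clockwise /prism_gt /=; lia. Qed.

Lemma clockwise_irr F : irreflexive (clockwise F).
Proof. by move=> [? ?]; rewrite /clockwise /prism_gt /=; lia. Qed.

(** Sorting needs a total relation, hence the reflexive closure; strictness comes back in
    [sector_sorted] because no letter is repeated. *)
Definition prism_ge (a b : nat * nat) : bool := (a == b) || prism_gt a b.

Definition sector (la : seq nat) (F : nat * nat -> nat) (s : nat) :
  seq (nat * nat) := sort prism_ge [seq x <- cells la | F x == s].

Definition circloid_of (la : seq nat) (F : nat * nat -> nat) :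
  seq (seq (nat * nat)) :=
  [seq sector la F s | s <- iota 1 (\max_(x <- cells la) F x)].

Lemma mem_sector la F s x :
  (x \in sector la F s) = (F x == s) && (x \in cells la).
Proof. by rewrite mem_sort mem_filter. Qed.

Lemma sector_sorted la F s : sorted prism_gt (sector la F s).
Proof.
have ge_trans : transitive prism_ge.
  by move=> [? ?] [? ?] [? ?]; rewrite /prism_ge /prism_gt !xpair_eqE /=; lia.
have ge_total : total prism_ge.
  by move=> [? ?] [? ?]; rewrite /prism_ge /prism_gt !xpair_eqE /=; lia.
have := sort_sorted ge_total [seq x <- cells la | F x == s].
have : uniq (sector la F s) by rewrite sort_uniq filter_uniq ?cells_uniq.
rewrite -/(sector la F s) uniq_pairwise (sorted_pairwise ge_trans).
rewrite (sorted_pairwise prism_gt_trans) => neq ge.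
have: pairwise [rel x y | (x != y) && prism_ge x y] (sector la F s).
  by rewrite pairwise_relI neq ge.
by apply: sub_pairwise => x y /=; rewrite /prism_ge; case: eqP.
Qed.

(** Entries grow from sector to sector, and the prismatic order breaks ties inside one. This reduces
    both statistics to comparisons under [clockwise F]. *)
Lemma circloid_of_sorted la F : sorted (clockwise F) (flatten (circloid_of la F)).
Proof.
rewrite (sorted_pairwise (@clockwise_trans F)) /circloid_of.
(* The number of the first sector is generalized too, as it shifts in the induction on the number of
   sectors. *)
elim: (\max_(x <- cells la) F x) 1 => //= n IH m.
rewrite pairwise_cat IH andbT; apply/andP; split.
  apply/allrelP => x y; rewrite mem_sector => /andP[/eqP Fx _].
  move=> /flatten_mapP[s]; rewrite mem_iota mem_sector => ms /andP[/eqP Fy _].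
  by rewrite /clockwise; lia.
have := sector_sorted la F m; rewrite (sorted_pairwise prism_gt_trans).
apply: (@sub_in_pairwise _ (mem (sector la F m))); last exact/allP.
move=> x y; rewrite !mem_sector => /andP[/eqP Fx _] /andP[/eqP Fy _] xy.
by rewrite /clockwise Fx Fy eqxx xy orbT.
Qed.

Lemma mem_flatten_circloid_of la (F : {fsfun nat * nat -> nat with 0}) x :
  filling_of la F -> (x \in flatten (circloid_of la F)) = (x \in cells la).
Proof.
move=> hF; apply/flatten_mapP/idP => [[s _]|xc].
  by rewrite mem_sector => /andP[].
exists (F x); last by rewrite mem_sector eqxx.
have : F x <= \max_(y <- cells la) F y by apply: leq_bigmax_seq.
by have := hF x; rewrite xc mem_iota; lia.
Qed.

Lemma circloid_of_perm la (F : {fsfun nat * nat -> nat with 0}) :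
  filling_of la F -> perm_eq (flatten (circloid_of la F)) (cells la).
Proof.
move=> hF; apply: uniq_perm (cells_uniq la) _ => [|x].
  have := circloid_of_sorted la F.
  exact: (sorted_uniq (@clockwise_trans F) (@clockwise_irr F)).
exact: mem_flatten_circloid_of.
Qed.

Lemma circloid_of_shape la F :
  circloid_shape (circloid_of la F) = filling_weight la F.
Proof.
rewrite /circloid_shape /circloid_of -map_comp; apply: eq_map => s /=.
by rewrite size_sort size_filter.
Qed.

Lemma max_attained (T : eqType) (s : seq T) (F : T -> nat) :
  0 < \max_(x <- s) F x -> exists2 x, x \in s & F x = \max_(y <- s) F y.
Proof.
elim: s => [|a s IH]; first by rewrite big_nil.
rewrite big_cons /maxn; case: ifP => [lt|_ _]; last by exists a; rewrite ?mem_head.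
by case/IH => x xs <-; exists x; rewrite // in_cons xs orbT.
Qed.

Lemma circloid_ofP la (F : {fsfun nat * nat -> nat with 0}) :
  filling_of la F -> is_circloid la (circloid_of la F).
Proof.
move=> hF; apply/and3P; split; last exact: circloid_of_perm.
- rewrite circloid_of_shape /filling_weight.
  (* A positive maximum is attained, so the last sector is nonempty; for maximum 0 there is no
     sector and [last] returns its default 1. *)
  have := @max_attained _ (cells la) F.
  case: (\max_(x <- cells la) F x) => // n /(_ isT)[x xc Fx].
  rewrite -(addn1 n) iotaD map_cat last_cat /= add1n -lt0n -has_count.
  by apply/hasP; exists x; rewrite // Fx.
- by apply/allP => _ /mapP[s _ ->]; apply: sector_sorted.
Qed.

Lemma mem_nth_circloid_of la F s x :
  (x \in nth [::] (circloid_of la F) s) = (F x == s.+1) && (x \in cells la).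
Proof.
set m := \max_(y <- cells la) F y.
have [lt|ge] := ltnP s m.
  by rewrite (nth_map 0) ?size_iota // nth_iota // mem_sector.
rewrite nth_default ?size_map ?size_iota // in_nil.
apply/esym/negbTE; apply/negP => /andP[/eqP Fx xc].
have : F x <= m by apply: leq_bigmax_seq.
lia.
Qed.

(** The entry of a cell is the number of the sector holding its letter, and off the shape both
    fillings vanish. *)
Lemma circloid_of_inj la (F G : {fsfun nat * nat -> nat with 0}) :
  filling_of la F -> filling_of la G ->
  circloid_of la F = circloid_of la G -> F = G.
Proof.
move=> hF hG E; apply/fsfunP => x.
have [xc|xc] := boolP (x \in cells la); last first.
  have := hF x; have := hG x; rewrite (negPf xc); lia.
have := mem_nth_circloid_of la F (F x).-1 x.
have := hF x; rewrite E mem_nth_circloid_of xc !andbT => /prednK ->.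
by rewrite eqxx => /eqP.
Qed.

Lemma find_flatten (T : eqType) (C : seq (seq T)) (x : T) (s : nat) :
  uniq (flatten C) -> x \in nth [::] C s ->
  find (fun w => x \in w) C = s.
Proof.
elim: C s => [|w C IH] [|s] //=; first by move=> _ ->.
rewrite cat_uniq => /and3P[_ /hasPn disj uC] xs.
have lt : s < size C.
  by rewrite ltnNge; apply/negP => ge; rewrite nth_default in xs.
have /disj /negPf -> : x \in flatten C.
  by apply/flattenP; exists (nth [::] C s); rewrite ?mem_nth.
by rewrite (IH s).
Qed.

(** The inverse gives each cell the number of the sector containing its letter; the successor in
    [sec] turns list positions into sector numbers starting at 1. *)
Lemma circloid_of_surj la C : is_circloid la C ->
  exists2 F : {fsfun nat * nat -> nat with 0},
    filling_of la F & circloid_of la F = C.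
Proof.
move=> /and3P[hlast hsort hperm].
have uC : uniq (flatten C) by rewrite (perm_uniq hperm) cells_uniq.
pose sec x := (find (fun w : seq (nat * nat) => x \in w) C).+1.
pose F : {fsfun nat * nat -> nat with 0} :=
  [fsfun x in [fset x in cells la]%fset => sec x | 0]%fset.
have FE x : F x = if x \in cells la then sec x else 0.
  by rewrite fsfunE !inE.
have hF : filling_of la F by move=> x; rewrite FE; case: ifP.
have secP s x : (x \in nth [::] C s) = (F x == s.+1) && (x \in cells la).
  rewrite FE; apply/idP/andP => [xs|[+ xc]].
    have -> : x \in cells la.
      rewrite -(perm_mem hperm); apply/flattenP; exists (nth [::] C s) => //.
      apply: mem_nth; rewrite ltnNge; apply/negP => ge.
      by rewrite nth_default in xs.
    by rewrite /sec (find_flatten uC xs).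
  rewrite xc /sec eqSS => /eqP <-; apply: (@nth_find _ [::] (fun w => x \in w)).
  move: xc; rewrite -(perm_mem hperm) => /flattenP[w wC xw].
  by apply/hasP; exists w.
have sizeE : \max_(x <- cells la) F x = size C.
  apply/eqP; rewrite eqn_leq; apply/andP; split.
    apply/bigmax_leqP_seq => x xc _; rewrite FE xc /sec -has_find.
    move: xc; rewrite -(perm_mem hperm) => /flattenP[w wC xw].
    by apply/hasP; exists w.
  (* If there are sectors, the last one is nonempty, and its first letter has the entry [size C]. *)
  case: (lastP C) hlast secP => // C' w.
  rewrite /circloid_shape map_rcons last_rcons size_rcons => w0 secP.
  case: w w0 secP => // x w _ secP.
  have := secP (size C') x; rewrite nth_rcons ltnn eqxx mem_head.
  move=> /esym /andP[/eqP <- xc].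
  by apply: leq_bigmax_seq.
exists F => //; apply: (@eq_from_nth _ [::]).
  by rewrite size_map size_iota.
rewrite size_map size_iota sizeE => s hs.
(* A strictly sorted word is determined by its set of letters. *)
apply: (irr_sorted_eq prism_gt_trans); last first.
- by move=> x; rewrite mem_nth_circloid_of secP.
- by apply: (allP hsort); rewrite mem_nth.
- by rewrite (nth_map 0) ?size_iota ?sizeE // sector_sorted.
- by move=> [? ?]; rewrite /prism_gt /=; lia.
Qed.

(** * Betrayal and inversions *)

Lemma betrayal_circloid_of la (F : {fsfun nat * nat -> nat with 0}) :
  is_partition la -> filling_of la F ->
  betrayal (circloid_of la F) = filling_inv la F.
Proof.
move=> hla hF; have hperm := circloid_of_perm hF.
rewrite /betrayal (perm_big _ hperm) /filling_inv.
apply: eq_big_seq => x xc; set w := flatten _.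
have sw := circloid_of_sorted la F; rewrite -/w in sw hperm.
have ct := circle_rel_trans (@clockwise_trans F).
have ci := circle_rel_irr (@clockwise_irr F).
have cs := circle_sorted (@clockwise_trans F) sw.
have uc : uniq (circle w) := sorted_uniq ct ci cs.
rewrite (count_sub_uniq _ _ uc); last first.
- by move=> p /mem_take; rewrite mem_rot.
- by rewrite take_uniq // rot_uniq.
rewrite /= add0n count_map (permP hperm); apply: eq_in_count => y yc /=.
have inw z : (Some z \in circle w) = (z \in cells la).
  by rewrite mem_circle (perm_mem hperm).
have Fx : 0 < F x by rewrite hF.
have Fy : 0 < F y by rewrite hF.
rewrite /inversion_triple eq_sym; case: eqVneq => //= xy.
case: ltnP => //= lt_xy.
have x0 : 0 < x.1 by move: xc; rewrite mem_cells => /andP[].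
(* Columns of the shape have no gaps, so the cell below [x] is again in the shape. *)
have bw : letter_below x \in circle w.
  rewrite /letter_below; case: eqP => [|x1]; first by rewrite mem_head.
  by rewrite inw; move: xc; rewrite !mem_cells_conj //=; lia.
rewrite (mem_arc_sorted ct ci cs bw) ?inw // /letter_below /=; last first.
  by case: (x.1 == 1) => //=; apply/eqP => -[E]; move: lt_xy; rewrite E ltnn.
move: x0 xy lt_xy Fx Fy; case: x {xc bw} => r c; case: y {yc} => r' c' /= r0 <- lt Fx Fy.
(* With u, w, v as in an inversion triple, tie-breaking turns the three cyclic cases into v < w < u,
   w < u <= v and u <= v < w, which together are the triple condition. In row 1 both sides reduce to
   w < u, since entries are positive and v = 0. *)
rewrite /clockwise /prism_gt /=; case: (r == 1) => /=; lia.
Qed.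

(** * Cocharge and the major index *)

(** Going from k-1 to k adds 1 unless the marked point is passed, that is, unless k precedes k-1 in
    the clockwise reading [s]. *)
Lemma cocharge_label_sum (r : rel nat) (s : seq nat) (m i : nat) :
  transitive r -> irreflexive r -> sorted r s -> s =i iota 1 m -> i <= m ->
  cocharge_label (rev s) i = \sum_(1 <= k < i.+1 | 2 <= k) ~~ r k k.-1.
Proof.
move=> rt ri rs sm; elim: i => [|[|i] IH] le; first by rewrite big_geq.
  by rewrite big_mkcond big_nat1.
have cs := circle_sorted rt rs.
rewrite big_mkcond big_nat_recr //= -big_mkcond -IH //=; last lia.
rewrite revK (mem_arc_sorted (circle_rel_trans rt) (circle_rel_irr ri) cs) //=;
  rewrite ?mem_circle ?sm ?mem_iota ?mem_head //; try lia.
by case: (r i.+2 i.+1); rewrite ?addn0 ?addn1.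
Qed.

(** Summation is exchanged: each k at which the label grows raises the labels of k, ..., m, which
    are m - k + 1 letters. *)
Lemma cocharge_perm_sum (r : rel nat) (s : seq nat) (m : nat) :
  transitive r -> irreflexive r -> sorted r s -> s =i iota 1 m ->
  cocharge_perm (rev s) =
    \sum_(k <- iota 1 m | (2 <= k) && ~~ r k k.-1) (m - k + 1).
Proof.
move=> rt ri rs sm.
have sz : size s = m.
  have us := sorted_uniq rt ri rs.
  by rewrite -(size_iota 1 m); apply: perm_size; rewrite uniq_perm ?iota_uniq.
rewrite /cocharge_perm size_rev sz.
rewrite (eq_big_nat _ _ (F2 := fun i => \sum_(1 <= k < i.+1 | 2 <= k) ~~ r k k.-1));
  last by move=> i ?; apply: cocharge_label_sum rt ri rs sm _; lia.
have -> : iota 1 m = index_iota 1 m.+1 by rewrite /index_iota subn1.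
(* Passing from m to m+1 raises the weight of every earlier k by one and brings in k = m+1 with
   weight 1. *)
elim: m {sm sz} => [|m IH]; first by rewrite !big_geq.
rewrite big_nat_recr //= IH !(big_mkcond (fun k => 2 <= k)).
rewrite !(big_mkcond (fun k => (2 <= k) && _)).
rewrite [X in _ + X]big_nat_recr //= [RHS]big_nat_recr //= addnA -big_split /=.
congr (_ + _); last by case: ltnP => //= _; case: (r _ _) => //=; lia.
apply: eq_big_nat => k /andP[_ km]; case: ltnP => //= _; case: (r _ _) => //=; lia.
Qed.

Lemma cocharge_circloid_of la (F : {fsfun nat * nat -> nat with 0}) :
  is_partition la -> filling_of la F ->
  cocharge la (circloid_of la F) = filling_maj la F.
Proof.
move=> hla hF; rewrite /filling_maj (perm_big _ (cells_perm_columns hla)).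
rewrite big_mkcond big_allpairs_dep /cocharge /index_iota subn1 /=.
apply: eq_big_seq => j; rewrite mem_iota => /andP[j0 _].
pose r : rel nat := fun a b => clockwise F (a, j) (b, j).
have rt : transitive r by move=> b a c; apply: clockwise_trans.
have ri : irreflexive r by move=> a; apply: clockwise_irr.
set w := flatten (circloid_of la F).
rewrite /color_word (cocharge_perm_sum rt ri (m := conj_part la j)); last first.
- move=> a; rewrite mem_iota; apply/mapP/idP => [[[a' j']]|aj].
    rewrite mem_filter /= mem_flatten_circloid_of // mem_cells_conj //=.
    by move=> /andP[/eqP -> +] ->; lia.
  exists (a, j) => //; rewrite mem_filter eqxx mem_flatten_circloid_of //.
  by rewrite mem_cells_conj //=; lia.
(* All remaining letters have color [j], so dropping the color carries [clockwise F] to [r]. *)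
- have := sorted_filter (@clockwise_trans F) (fun x => x.2 == j) (circloid_of_sorted la F).
  apply: (@homo_sorted_in _ _ [pred x | x.2 == j]); last exact: filter_all.
  by move=> [a a'] [b b'] /eqP /= -> /eqP /= ->.
rewrite big_mkcond; apply: eq_big_seq => k _ /=; congr (if _ then _ else _).
(* In a column a tie puts the larger letter first, so k fails to precede k-1 exactly when (k, j) is
   a descent. *)
case: ltnP => //= k2; rewrite /r /clockwise /prism_gt /=; lia.
Qed.

Theorem theorem12 (la : seq nat) (hla : is_partition la) :
  modified_macdonald la =
  formal_sum [set C | is_circloid la C]%classic
    (fun C => qvar ^+ betrayal C * tvar ^+ cocharge la C)%R circloid_shape.
Proof.
apply/funext => ga; rewrite /modified_macdonald /formal_sum.
(* Since shape equals weight, the bijection restricts to the fibres over each exponent [ga]. *)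
rewrite (reindex_fsbig (fun F : {fsfun nat * nat -> nat with 0} => circloid_of la F)
  [set F | filling_of la F /\ comp_eq (filling_weight la F) ga]%classic) /=; last first.
  split.
  - move=> F /= [hF Fga]; split; first exact: circloid_ofP.
    by rewrite circloid_of_shape.
  - by move=> F G /set_mem[hF _] /set_mem[hG _]; apply: circloid_of_inj.
  - move=> C [/circloid_of_surj[F hF <-] Fga]; exists F => //; split=> //.
    by rewrite -circloid_of_shape.
apply: eq_fsbigr => F /set_mem[hF _].
by rewrite betrayal_circloid_of // cocharge_circloid_of.
Qed.
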